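(* Let $\mathcal D$ be a PRO and $(\mathcal M,\lozenge,\Psi,u)$ a $\mathcal C$-actegory. A (strict) representation $\tilde{\mathbf T}^\bullet:\mathcal D\to\mathrm{End}_{\mathcal C}(\mathcal M)$ is the same as a pair $(\mathbf T,l)$ where $\mathbf T^\bullet:\mathcal D\to\mathrm{End}(\mathcal M)$ is a (strict) representation and, with $T:=\mathbf T^\bullet(1)$ (so $\mathbf T^\bullet(n)=T^n$), $l$ is a binatural transformation $l_{C,M}:T(C\lozenge M)\to C\lozenge T(M)$ such that for all $A,B,C\in\mathrm{Ob}\,\mathcal C$, $M\in\mathrm{Ob}\,\mathcal M$: (1) $u_{TM}\circ l_{\mathbf 1,M}=T(u_M)$; (2) $\Psi_{A,B,TM}\circ l_{A\otimes B,M}=(A\lozenge l_{B,M})\circ l_{A,B\lozenge M}\circ T(\Psi_{A,B,M})$; (3) for every morphism $\alpha:n\to m$ of $\mathcal D$, with $\alpha$ also denoting the natural transformation $\mathbf T^\bullet(\alpha):T^n\Rightarrow T^m$, $$(C\lozenge\alpha_M)\circ l_{C,T^{n-1}M}\circ T(l_{C,T^{n-2}M})\circ\cdots\circ T^{n-1}(l_{C,M})=l_{C,T^{m-1}M}\circ T(l_{C,T^{m-2}M})\circ\cdots\circ T^{m-1}(l_{C,M})\circ\alpha_{C\lozenge M}$$ as morphisms $T^n(C\lozenge M)\to C\lozenge T^mM$ (an empty composite being the identity).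
   Context: A PRO is a strict monoidal category whose objects are the natural numbers (including $0$), with tensor product on objects the addition and unit object $0$. A (strict) representation of a PRO $\mathcal D$ in a strict monoidal category $\mathcal E$ is a strict monoidal functor $\mathcal D\to\mathcal E$. $\mathrm{End}(\mathcal M)$ is the strict monoidal category of endofunctors of $\mathcal M$ and natural transformations, with composition as tensor product. $\mathcal C$ is a fixed monoidal category with product $\otimes$, unit $\mathbf 1$, associativity isomorphisms $a_{X,Y,Z}:X\otimes(Y\otimes Z)\to(X\otimes Y)\otimes Z$ and unit isomorphisms $l_A:\mathbf 1\otimes A\to A$, $r_A:A\otimes\mathbf 1\to A$. A $\mathcal C$-actegory is a category $\mathcal N$ with a bifunctor $\lozenge:\mathcal C\times\mathcal N\to\mathcal N$ and natural isomorphisms $\Psi_{Q,Q',N}:(Q\otimes Q')\lozenge N\to Q\lozenge(Q'\lozenge N)$, $u_N:\mathbf 1\lozenge N\to N$ such that $\Psi_{Q,Q',Q''\lozenge N}\circ\Psi_{Q\otimes Q',Q'',N}\circ(a_{Q,Q',Q''}\lozenge N)=(Q\lozenge\Psi_{Q',Q'',N})\circ\Psi_{Q,Q'\otimes Q'',N}$, $u_{Q\lozenge N}\circ\Psi_{\mathbf 1,Q,N}=l_Q\lozenge N$, $(Q\lozenge u_N)\circ\Psi_{Q,\mathbf 1,N}=r_Q\lozenge N$. $\mathrm{End}_{\mathcal C}(\mathcal M)$ is the strict monoidal category whose objects are colax $\mathcal C$-equivariant endofunctors of $\mathcal M$, i.e. pairs $(F,\zeta)$ with $F:\mathcal M\to\mathcal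 M$ a functor and $\zeta_{C,M}:F(C\lozenge M)\to C\lozenge F(M)$ binatural with $u_{F(M)}\circ\zeta_{\mathbf 1,M}=F(u_M)$ and $\Psi_{A,B,F(M)}\circ\zeta_{A\otimes B,M}=(A\lozenge\zeta_{B,M})\circ\zeta_{A,B\lozenge M}\circ F(\Psi_{A,B,M})$; whose morphisms $(F,\zeta^F)\to(G,\zeta^G)$ are natural transformations $\alpha:F\Rightarrow G$ with $(C\lozenge\alpha_M)\circ\zeta^F_{C,M}=\zeta^G_{C,M}\circ\alpha_{C\lozenge M}$; and whose tensor product is composition, $(F,\zeta^F)\circ(G,\zeta^G)=(F\circ G,\zeta^{F\circ G})$, $\zeta^{F\circ G}_{C,M}=\zeta^F_{C,GM}\circ F(\zeta^G_{C,M})$, with unit $(\mathrm{Id},\mathrm{id})$. ''The same as'' means that $\tilde{\mathbf T}^\bullet\mapsto(\mathbf T^\bullet,l)$, where $\mathbf T^\bullet$ is the underlying representation (forgetting the coherences) and $l$ is the coherence of $\tilde{\mathbf T}^\bullet(1)=(T,l)$, is a bijection. *)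

(* Defs.v *)
From mathcomp Require Import all_boot.
From mathcomp Require Import boolp.

Set Implicit Arguments.
Unset Strict Implicit.
Unset Printing Implicit Defensive.

Declare Scope cat_scope.
Delimit Scope cat_scope with cat.
Local Open Scope cat_scope.

Record category := Category {
  Ob :> Type;
  hom : Ob -> Ob -> Type;
  idc : forall A : Ob, hom A A;
  comp : forall A B C : Ob, hom B C -> hom A B -> hom A C;
  comp_idl : forall (A B : Ob) (f : hom A B), comp (idc B) f = f;
  comp_idr : forall (A B : Ob) (f : hom A B), comp f (idc A) = f;
  comp_assoc : forall (A B C D : Ob) (h : hom C D) (g : hom B C) (f : hom A B),
    comp h (comp g f) = comp (comp h g) f }.

Arguments hom {c} _ _.
Arguments idc {c} _.
Arguments comp {c A B C} _ _.

Notation "g ∘ f" := (comp g f) (at level 40, left associativity) : cat_scope.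

(* Equality of morphisms whose endpoints are only propositionally equal, as
   needed to express strictness; for morphisms with the same endpoints it
   coincides with Leibniz equality (hom_eqP below). *)
Inductive hom_eq (C : category) (A B : C) (f : hom A B) :
    forall A' B' : C, hom A' B' -> Prop :=
  hom_eq_refl : hom_eq f f.

Arguments hom_eq {C A B} f {A' B'} _.

Definition cast_hom (C : category) (A A' B B' : C) (eA : A = A') (eB : B = B')
    (f : hom A B) : hom A' B' :=
  match eA in _ = X, eB in _ = Y return hom X Y with
  | erefl, erefl => f
  end.

Definition is_iso (C : category) (A B : C) (f : hom A B) : Prop :=
  exists2 g : hom B A, g ∘ f = idc A & f ∘ g = idc B.

Record functor (C D : category) := Functor {
  fob :> C -> D;
  fmap : forall A B : C, hom A B -> hom (fob A) (fob B);
  fmap_id : forall A : C, fmap (idc A) = idc (fob A);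
  fmap_comp : forall (X Y Z : C) (g : hom Y Z) (f : hom X Y),
    fmap (g ∘ f) = fmap g ∘ fmap f }.

Arguments fmap {C D} _ {A B} _.

Record bifunctor (C D E : category) := Bifunctor {
  bob :> C -> D -> E;
  bmap : forall (A A' : C) (B B' : D),
    hom A A' -> hom B B' -> hom (bob A B) (bob A' B');
  bmap_id : forall (A : C) (B : D), bmap (idc A) (idc B) = idc (bob A B);
  bmap_comp : forall (A1 A2 A3 : C) (B1 B2 B3 : D)
      (f' : hom A2 A3) (f : hom A1 A2) (g' : hom B2 B3) (g : hom B1 B2),
    bmap (f' ∘ f) (g' ∘ g) = bmap f' g' ∘ bmap f g }.

Arguments bmap {C D E} _ {A A' B B'} _ _.

Record nattrans (C D : category) (F G : functor C D) := Nattrans {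
  ncomp :> forall A : C, hom (F A) (G A);
  ncomp_nat : forall (A B : C) (f : hom A B),
    ncomp B ∘ fmap F f = fmap G f ∘ ncomp A }.

Program Definition fid (C : category) : functor C C :=
  @Functor C C (fun A => A) (fun A B f => f) _ _.

Program Definition fcomp (C D E : category) (F : functor D E) (G : functor C D) :
    functor C E :=
  @Functor C E (fun A => F (G A)) (fun A B f => fmap F (fmap G f)) _ _.
Next Obligation. by rewrite !fmap_id. Qed.
Next Obligation. by rewrite !fmap_comp. Qed.

(* Recursing on the inside makes T^n X reduce to T (T (... (T X))). *)
Fixpoint fpow (C : category) (T : functor C C) (n : nat) : functor C C :=
  if n is k.+1 then fcomp (fpow T k) T else fid C.

Program Definition nt_id (C D : category) (F : functor C D) : nattrans F F :=
  @Nattrans C D F F (fun A => idc (F A)) _.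
Next Obligation. by rewrite comp_idl comp_idr. Qed.

Program Definition nt_comp (C D : category) (F G H : functor C D)
    (b : nattrans G H) (a : nattrans F G) : nattrans F H :=
  @Nattrans C D F H (fun A => b A ∘ a A) _.
Next Obligation. by rewrite /= -comp_assoc ncomp_nat comp_assoc ncomp_nat comp_assoc. Qed.

Program Definition nt_hcomp (C D E : category) (F F' : functor D E)
    (G G' : functor C D) (a : nattrans F F') (b : nattrans G G') :
    nattrans (fcomp F G) (fcomp F' G') :=
  @Nattrans C E (fcomp F G) (fcomp F' G')
    (fun A => a (G' A) ∘ fmap F (b A)) _.
Next Obligation.
by rewrite /= -comp_assoc -fmap_comp (ncomp_nat b) fmap_comp comp_assoc ncomp_nat
  comp_assoc.
Qed.

Lemma hom_eqP (C : category) (A B : C) (f g : hom A B) : hom_eq f g <-> f = g.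
Proof.
split=> [e|->]; last exact: hom_eq_refl.
have cast_eq A' B' (h : hom A' B') (eA : A = A') (eB : B = B') :
  hom_eq f h -> cast_hom eA eB f = h.
  move=> fh; case: fh eA eB => eA eB.
  by rewrite (Prop_irrelevance eA erefl) (Prop_irrelevance eB erefl).
exact: (cast_eq _ _ g erefl erefl e).
Qed.

Lemma hom_eq_trans (C : category) (A B A' B' A'' B'' : C)
    (f : hom A B) (g : hom A' B') (h : hom A'' B'') :
  hom_eq f g -> hom_eq g h -> hom_eq f h.
Proof. by move=> fg gh; case: gh. Qed.

Lemma fmap_hom_eq (C D : category) (F : functor C D) (A B A' B' : C)
    (f : hom A B) (g : hom A' B') :
  hom_eq f g -> hom_eq (fmap F f) (fmap F g).
Proof. by case=> *; exact: hom_eq_refl. Qed.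

Lemma functor_ext (C D : category) (F G : functor C D) :
  (forall A, F A = G A) ->
  (forall A B (f : hom A B), hom_eq (fmap F f) (fmap G f)) -> F = G.
Proof.
case: F G => [F Fm F1 FM] [G Gm G1 GM] /= /funext eFG.
case: _ / eFG in Gm G1 GM * => eFm.
have eqm : Fm = Gm.
  by apply: functional_extensionality_dep => A;
    apply: functional_extensionality_dep => B;
    apply: functional_extensionality_dep => f; apply/hom_eqP.
case: _ / eqm in G1 GM eFm *.
by rewrite (Prop_irrelevance F1 G1) (Prop_irrelevance FM GM).
Qed.

Lemma nattrans_ext (C D : category) (F G : functor C D) (a b : nattrans F G) :
  (forall A, a A = b A) -> a = b.
Proof.
case: a b => [a an] [b bn] /= e.
have {}e : a = b by exact: functional_extensionality_dep.
case: _ / e in bn *.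
by rewrite (Prop_irrelevance an bn).
Qed.

(* The action of the tensor product on objects is a parameter, so that it can
   be prescribed in the definition of a PRO. *)
Record strict_monoidal_on (C : category) (ot : C -> C -> C) (I : C) :=
  StrictMonoidalOn {
  ot_map : forall A A' B B' : C,
    hom A A' -> hom B B' -> hom (ot A B) (ot A' B');
  ot_map_id : forall A B : C, ot_map (idc A) (idc B) = idc (ot A B);
  ot_map_comp : forall (A1 A2 A3 B1 B2 B3 : C)
      (f' : hom A2 A3) (f : hom A1 A2) (g' : hom B2 B3) (g : hom B1 B2),
    ot_map (f' ∘ f) (g' ∘ g) = ot_map f' g' ∘ ot_map f g;
  ot_assoc : forall X Y Z : C, ot X (ot Y Z) = ot (ot X Y) Z;
  ot_unitl : forall X : C, ot I X = X;
  ot_unitr : forall X : C, ot X I = X;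
  ot_map_assoc : forall (X X' Y Y' Z Z' : C)
      (f : hom X X') (g : hom Y Y') (h : hom Z Z'),
    hom_eq (ot_map f (ot_map g h)) (ot_map (ot_map f g) h);
  ot_map_unitl : forall (X X' : C) (f : hom X X'), hom_eq (ot_map (idc I) f) f;
  ot_map_unitr : forall (X X' : C) (f : hom X X'), hom_eq (ot_map f (idc I)) f }.

Record strict_monoidal := StrictMonoidal {
  sm_cat :> category;
  sm_ot : sm_cat -> sm_cat -> sm_cat;
  sm_unit : sm_cat;
  sm_str : strict_monoidal_on sm_ot sm_unit }.

Arguments sm_ot {s} _ _.
Arguments sm_unit {s}.

Definition sm_map (D : strict_monoidal) (A A' B B' : D)
    (f : hom A A') (g : hom B B') : hom (sm_ot A B) (sm_ot A' B') :=
  ot_map (sm_str D) f g.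

Record strict_functor (D E : strict_monoidal) := StrictFunctor {
  sf_fun :> functor D E;
  sf_unit : sf_fun sm_unit = sm_unit;
  sf_ot : forall A B : D, sf_fun (sm_ot A B) = sm_ot (sf_fun A) (sf_fun B);
  sf_map : forall (A A' B B' : D) (f : hom A A') (g : hom B B'),
    hom_eq (fmap sf_fun (sm_map f g)) (sm_map (fmap sf_fun f) (fmap sf_fun g)) }.

Program Definition sf_comp (C D E : strict_monoidal)
    (F : strict_functor D E) (G : strict_functor C D) : strict_functor C E :=
  @StrictFunctor C E (fcomp F G) _ _ _.
Next Obligation. by rewrite /= !sf_unit. Qed.
Next Obligation. by rewrite /= !sf_ot. Qed.
Next Obligation.
exact: hom_eq_trans (fmap_hom_eq F (sf_map G f g)) (sf_map F _ _).
Qed.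

Record PRO := MkPRO {
  pro_hom : nat -> nat -> Type;
  pro_id : forall n, pro_hom n n;
  pro_comp : forall n m p, pro_hom m p -> pro_hom n m -> pro_hom n p;
  pro_idl : forall n m (f : pro_hom n m), pro_comp (pro_id m) f = f;
  pro_idr : forall n m (f : pro_hom n m), pro_comp f (pro_id n) = f;
  pro_assoc : forall n m p q (h : pro_hom p q) (g : pro_hom m p)
    (f : pro_hom n m), pro_comp h (pro_comp g f) = pro_comp (pro_comp h g) f;
  pro_str : @strict_monoidal_on (Category pro_idl pro_idr pro_assoc) addn 0 }.

Definition PRO_strict_monoidal (D : PRO) : strict_monoidal :=
  StrictMonoidal (pro_str D).
Coercion PRO_strict_monoidal : PRO >-> strict_monoidal.

Program Definition EndCat (M : category) : category :=
  @Category (functor M M) (@nattrans M M) (@nt_id M M) (@nt_comp M M) _ _ _.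
Next Obligation. by apply: nattrans_ext => x /=; rewrite comp_idl. Qed.
Next Obligation. by apply: nattrans_ext => x /=; rewrite comp_idr. Qed.
Next Obligation. by apply: nattrans_ext => x /=; rewrite comp_assoc. Qed.

Lemma nattrans_hom_eq (M : category) (F G F' G' : functor M M)
    (a : nattrans F G) (b : nattrans F' G') :
  F = F' -> G = G' -> (forall A, hom_eq (a A) (b A)) ->
  @hom_eq (EndCat M) F G a F' G' b.
Proof.
move=> eF eG; case: _ / eF in b *; case: _ / eG in b * => eab.
by apply/hom_eqP; apply: nattrans_ext => A; apply/hom_eqP.
Qed.

Lemma fcomp_assoc (M : category) (F G H : functor M M) :
  fcomp F (fcomp G H) = fcomp (fcomp F G) H.
Proof. by apply: functor_ext => // *; exact: hom_eq_refl. Qed.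

Lemma fcomp_idl (M : category) (F : functor M M) : fcomp (fid M) F = F.
Proof. by apply: functor_ext => // *; exact: hom_eq_refl. Qed.

Lemma fcomp_idr (M : category) (F : functor M M) : fcomp F (fid M) = F.
Proof. by apply: functor_ext => // *; exact: hom_eq_refl. Qed.

Lemma nt_hcomp_id (M : category) (F G : functor M M) :
  nt_hcomp (nt_id F) (nt_id G) = nt_id (fcomp F G).
Proof. by apply: nattrans_ext => A /=; rewrite fmap_id comp_idl. Qed.

Lemma nt_hcomp_comp (M : category) (F1 F2 F3 G1 G2 G3 : functor M M)
    (f' : nattrans F2 F3) (f : nattrans F1 F2)
    (g' : nattrans G2 G3) (g : nattrans G1 G2) :
  nt_hcomp (nt_comp f' f) (nt_comp g' g) =
  nt_comp (nt_hcomp f' g') (nt_hcomp f g).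
Proof.
apply: nattrans_ext => A /=.
rewrite fmap_comp !comp_assoc; congr (_ ∘ _).
by rewrite -!comp_assoc ncomp_nat.
Qed.

Program Definition End (M : category) : strict_monoidal :=
  @StrictMonoidal (EndCat M) (@fcomp M M M) (fid M)
    (@StrictMonoidalOn (EndCat M) (@fcomp M M M) (fid M)
      (fun F F' G G' a b => nt_hcomp a b) _ _ _ _ _ _ _ _).
Next Obligation. exact: nt_hcomp_id. Qed.
Next Obligation. exact: nt_hcomp_comp. Qed.
Next Obligation. exact: fcomp_assoc. Qed.
Next Obligation. exact: fcomp_idl. Qed.
Next Obligation. exact: fcomp_idr. Qed.
Next Obligation.
apply: nattrans_hom_eq; [exact: fcomp_assoc | exact: fcomp_assoc |].
by move=> A /=; apply/hom_eqP; rewrite fmap_comp comp_assoc.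
Qed.
Next Obligation.
apply: nattrans_hom_eq; [exact: fcomp_idl | exact: fcomp_idl |].
by move=> A /=; apply/hom_eqP; rewrite comp_idl.
Qed.
Next Obligation.
apply: nattrans_hom_eq; [exact: fcomp_idr | exact: fcomp_idr |].
by move=> A /=; apply/hom_eqP; rewrite fmap_id comp_idr.
Qed.

Record monoidal := Monoidal {
  mon_cat :> category;
  mon_tensor : bifunctor mon_cat mon_cat mon_cat;
  mon_unit : mon_cat;
  mon_a : forall X Y Z : mon_cat,
    hom (mon_tensor X (mon_tensor Y Z)) (mon_tensor (mon_tensor X Y) Z);
  mon_l : forall A : mon_cat, hom (mon_tensor mon_unit A) A;
  mon_r : forall A : mon_cat, hom (mon_tensor A mon_unit) A;
  mon_a_nat : forall (X X' Y Y' Z Z' : mon_cat)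
      (f : hom X X') (g : hom Y Y') (h : hom Z Z'),
    mon_a X' Y' Z' ∘ bmap mon_tensor f (bmap mon_tensor g h) =
    bmap mon_tensor (bmap mon_tensor f g) h ∘ mon_a X Y Z;
  mon_l_nat : forall (A B : mon_cat) (f : hom A B),
    mon_l B ∘ bmap mon_tensor (idc mon_unit) f = f ∘ mon_l A;
  mon_r_nat : forall (A B : mon_cat) (f : hom A B),
    mon_r B ∘ bmap mon_tensor f (idc mon_unit) = f ∘ mon_r A;
  mon_a_iso : forall X Y Z : mon_cat, is_iso (mon_a X Y Z);
  mon_l_iso : forall A : mon_cat, is_iso (mon_l A);
  mon_r_iso : forall A : mon_cat, is_iso (mon_r A);
  mon_pentagon : forall X Y Z W : mon_cat,
    mon_a (mon_tensor X Y) Z W ∘ mon_a X Y (mon_tensor Z W) =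
    bmap mon_tensor (mon_a X Y Z) (idc W) ∘ mon_a X (mon_tensor Y Z) W
      ∘ bmap mon_tensor (idc X) (mon_a Y Z W);
  mon_triangle : forall X Y : mon_cat,
    bmap mon_tensor (mon_r X) (idc Y) ∘ mon_a X mon_unit Y =
    bmap mon_tensor (idc X) (mon_l Y) }.

Arguments mon_unit {m}.
Arguments mon_a {m} X Y Z.
Arguments mon_l {m} A.
Arguments mon_r {m} A.

Notation "A ⊗ B" := (mon_tensor _ A B)
  (at level 35, right associativity) : cat_scope.
Notation "𝟏" := mon_unit : cat_scope.

Record actegory (C : monoidal) := Actegory {
  act_cat :> category;
  act : bifunctor C act_cat act_cat;
  act_Psi : forall (Q Q' : C) (N : act_cat), hom (act (Q ⊗ Q') N) (act Q (act Q' N));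
  act_u : forall N : act_cat, hom (act 𝟏 N) N;
  act_Psi_nat : forall (Q1 Q2 Q1' Q2' : C) (N1 N2 : act_cat)
      (f : hom Q1 Q2) (f' : hom Q1' Q2') (g : hom N1 N2),
    act_Psi Q2 Q2' N2 ∘ bmap act (bmap (mon_tensor C) f f') g =
    bmap act f (bmap act f' g) ∘ act_Psi Q1 Q1' N1;
  act_u_nat : forall (N1 N2 : act_cat) (g : hom N1 N2),
    act_u N2 ∘ bmap act (idc 𝟏) g = g ∘ act_u N1;
  act_Psi_iso : forall (Q Q' : C) (N : act_cat), is_iso (act_Psi Q Q' N);
  act_u_iso : forall N : act_cat, is_iso (act_u N);
  act_pentagon : forall (Q Q' Q'' : C) (N : act_cat),
    act_Psi Q Q' (act Q'' N) ∘ act_Psi (Q ⊗ Q') Q'' N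
      ∘ bmap act (mon_a Q Q' Q'') (idc N) =
    bmap act (idc Q) (act_Psi Q' Q'' N) ∘ act_Psi Q (Q' ⊗ Q'') N;
  act_unitl : forall (Q : C) (N : act_cat),
    act_u (act Q N) ∘ act_Psi 𝟏 Q N = bmap act (mon_l Q) (idc N);
  act_unitr : forall (Q : C) (N : act_cat),
    bmap act (idc Q) (act_u N) ∘ act_Psi Q 𝟏 N = bmap act (mon_r Q) (idc N) }.

Arguments act {C} _.
Arguments act_Psi {C a} Q Q' N.
Arguments act_u {C a} N.

Notation "A ◊ M" := (act _ A M) (at level 35, right associativity) : cat_scope.
Notation "f ◊' g" := (bmap (act _) f g)
  (at level 35, right associativity) : cat_scope.

Record binatural (C : monoidal) (M : actegory C) (F : functor M M) := Binatural {
  bin :> forall (c : C) (x : M), hom (F (c ◊ x)) (c ◊ F x);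
  bin_nat : forall (c c' : C) (x x' : M) (f : hom c c') (g : hom x x'),
    bin c' x' ∘ fmap F (f ◊' g) = (f ◊' fmap F g) ∘ bin c x }.

Record colax (C : monoidal) (M : actegory C) := Colax {
  colax_fun :> functor M M;
  colax_zeta : binatural colax_fun;
  colax_unit : forall x : M,
    act_u (colax_fun x) ∘ colax_zeta 𝟏 x = fmap colax_fun (act_u x);
  colax_tensor : forall (A B : C) (x : M),
    act_Psi A B (colax_fun x) ∘ colax_zeta (A ⊗ B) x =
    (idc A ◊' colax_zeta B x) ∘ colax_zeta A (B ◊ x)
      ∘ fmap colax_fun (act_Psi A B x) }.

Record colax_hom (C : monoidal) (M : actegory C) (F G : colax M) := ColaxHom {
  ch_nt :> nattrans F G;
  ch_colax : forall (c : C) (x : M),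
    (idc c ◊' ch_nt x) ∘ colax_zeta F c x = colax_zeta G c x ∘ ch_nt (c ◊ x) }.

Lemma binatural_ext (C : monoidal) (M : actegory C) (F : functor M M)
    (l l' : binatural F) : (forall c x, l c x = l' c x) -> l = l'.
Proof.
case: l l' => [l ln] [l' ln'] /= e.
have {}e : l = l' by
  apply: functional_extensionality_dep => c; apply: functional_extensionality_dep.
by case: _ / e in ln' *; rewrite (Prop_irrelevance ln ln').
Qed.

Lemma colax_ext (C : monoidal) (M : actegory C) (F G : colax M) :
  colax_fun F = colax_fun G ->
  (forall c x, hom_eq (colax_zeta F c x) (colax_zeta G c x)) -> F = G.
Proof.
case: F G => [F z zu zt] [G z' zu' zt'] /= eFG.
case: _ / eFG in z' zu' zt' * => ez.
have {}ez : z = z' by apply: binatural_ext => c x; apply/hom_eqP.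
case: _ / ez in zu' zt' *.
by rewrite (Prop_irrelevance zu zu') (Prop_irrelevance zt zt').
Qed.

Lemma colax_hom_ext (C : monoidal) (M : actegory C) (F G : colax M)
    (a b : colax_hom F G) : (forall x, a x = b x) -> a = b.
Proof.
case: a b => [a an] [b bn] /= e.
have {}e : a = b by exact: nattrans_ext.
by case: _ / e in bn *; rewrite (Prop_irrelevance an bn).
Qed.

Lemma bmap_compl (C D E : category) (T : bifunctor C D E) (A : C) (X Y Z : D)
    (g : hom Y Z) (f : hom X Y) :
  bmap T (idc A) (g ∘ f) = bmap T (idc A) g ∘ bmap T (idc A) f.
Proof. by rewrite -bmap_comp comp_idl. Qed.

Section EndC.
Variables (C : monoidal) (M : actegory C).

Program Definition bin_id : binatural (fid M) :=
  @Binatural C M (fid M) (fun c x => idc (c ◊ x)) _.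
Next Obligation. by rewrite comp_idl comp_idr. Qed.

Program Definition bin_comp (F G : functor M M) (k : binatural F) (l : binatural G) :
    binatural (fcomp F G) :=
  @Binatural C M (fcomp F G) (fun c x => k c (G x) ∘ fmap F (l c x)) _.
Next Obligation.
by rewrite -comp_assoc -fmap_comp bin_nat fmap_comp comp_assoc bin_nat comp_assoc.
Qed.

Program Definition colax_id : colax M := @Colax C M (fid M) bin_id _ _.
Next Obligation. by rewrite comp_idr. Qed.
Next Obligation. by rewrite bmap_id !comp_idr comp_idl. Qed.

Program Definition colax_comp (F G : colax M) : colax M :=
  @Colax C M (fcomp F G) (bin_comp (colax_zeta F) (colax_zeta G)) _ _.
Next Obligation.
by rewrite comp_assoc colax_unit -fmap_comp colax_unit.
Qed.
Next Obligation.
rewrite comp_assoc colax_tensor -!comp_assoc -fmap_comp colax_tensor.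
rewrite bmap_compl !fmap_comp !comp_assoc; congr (_ ∘ _ ∘ _).
by rewrite -!comp_assoc bin_nat.
Qed.

Program Definition ch_id (F : colax M) : colax_hom F F :=
  @ColaxHom C M F F (nt_id F) _.
Next Obligation. by rewrite bmap_id comp_idl comp_idr. Qed.

Program Definition ch_comp (F G H : colax M) (b : colax_hom G H) (a : colax_hom F G) :
    colax_hom F H := @ColaxHom C M F H (nt_comp b a) _.
Next Obligation.
by rewrite bmap_compl -comp_assoc ch_colax comp_assoc ch_colax comp_assoc.
Qed.

Program Definition ch_hcomp (F F' G G' : colax M)
    (a : colax_hom F F') (b : colax_hom G G') :
    colax_hom (colax_comp F G) (colax_comp F' G') :=
  @ColaxHom C M (colax_comp F G) (colax_comp F' G') (nt_hcomp a b) _.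
Next Obligation.
rewrite bmap_compl -!comp_assoc (comp_assoc _ (colax_zeta F c (G x))).
rewrite -bin_nat -!comp_assoc -fmap_comp ch_colax fmap_comp.
rewrite !comp_assoc ch_colax -!comp_assoc; congr (_ ∘ _).
by rewrite (comp_assoc _ (fmap F (colax_zeta G' c x))) (ncomp_nat a) -comp_assoc.
Qed.

Program Definition EndCCat : category :=
  @Category (colax M) (@colax_hom C M) ch_id ch_comp _ _ _.
Next Obligation. by apply: colax_hom_ext => x /=; rewrite comp_idl. Qed.
Next Obligation. by apply: colax_hom_ext => x /=; rewrite comp_idr. Qed.
Next Obligation. by apply: colax_hom_ext => x /=; rewrite comp_assoc. Qed.

Lemma colax_hom_hom_eq (F G F' G' : colax M)
    (a : colax_hom F G) (b : colax_hom F' G') :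
  F = F' -> G = G' -> (forall x, hom_eq (a x) (b x)) ->
  @hom_eq EndCCat F G a F' G' b.
Proof.
move=> eF eG; case: _ / eF in b *; case: _ / eG in b * => eab.
by apply/hom_eqP; apply: colax_hom_ext => x; apply/hom_eqP.
Qed.

Lemma colax_comp_assoc (F G H : colax M) :
  colax_comp F (colax_comp G H) = colax_comp (colax_comp F G) H.
Proof.
apply: colax_ext => [|c x /=]; first exact: fcomp_assoc.
by apply/hom_eqP; rewrite fmap_comp comp_assoc.
Qed.

Lemma colax_comp_idl (F : colax M) : colax_comp colax_id F = F.
Proof.
apply: colax_ext => [|c x /=]; first exact: fcomp_idl.
by apply/hom_eqP; rewrite comp_idl.
Qed.

Lemma colax_comp_idr (F : colax M) : colax_comp F colax_id = F.
Proof.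
apply: colax_ext => [|c x /=]; first exact: fcomp_idr.
by apply/hom_eqP; rewrite fmap_id comp_idr.
Qed.

Program Definition EndC : strict_monoidal :=
  @StrictMonoidal EndCCat colax_comp colax_id
    (@StrictMonoidalOn EndCCat colax_comp colax_id
      (fun F F' G G' a b => ch_hcomp a b) _ _ _ _ _ _ _ _).
Next Obligation. by apply: colax_hom_ext => x /=; rewrite fmap_id comp_idl. Qed.
Next Obligation.
apply: colax_hom_ext => x /=.
rewrite fmap_comp !comp_assoc; congr (_ ∘ _).
by rewrite -!comp_assoc ncomp_nat.
Qed.
Next Obligation. exact: colax_comp_assoc. Qed.
Next Obligation. exact: colax_comp_idl. Qed.
Next Obligation. exact: colax_comp_idr. Qed.
Next Obligation.
apply: colax_hom_hom_eq; [exact: colax_comp_assoc | exact: colax_comp_assoc |].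
by move=> x /=; apply/hom_eqP; rewrite fmap_comp comp_assoc.
Qed.
Next Obligation.
apply: colax_hom_hom_eq; [exact: colax_comp_idl | exact: colax_comp_idl |].
by move=> x /=; apply/hom_eqP; rewrite comp_idl.
Qed.
Next Obligation.
apply: colax_hom_hom_eq; [exact: colax_comp_idr | exact: colax_comp_idr |].
by move=> x /=; apply/hom_eqP; rewrite fmap_id comp_idr.
Qed.

Program Definition forget_colax_functor : functor EndC (End M) :=
  @Functor EndC (End M) (fun F : colax M => colax_fun F)
    (fun (F G : colax M) (a : colax_hom F G) => ch_nt a) _ _.

Program Definition forget_colax : strict_functor EndC (End M) :=
  @StrictFunctor EndC (End M) forget_colax_functor _ _ _.
Next Obligation. exact: hom_eq_refl. Qed.

End EndC.

Definition representation (D : PRO) (E : strict_monoidal) : Type :=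
  strict_functor D E.

Section Representations.
Variable D : PRO.

Definition rep_fun (M : category) (T : representation D (End M)) (n : nat) :
  functor M M := (T : strict_functor D (End M)) n.

Lemma rep_pow (M : category) (T : representation D (End M)) (n : nat) :
  rep_fun T n = fpow (rep_fun T 1) n.
Proof.
elim: n => [|n IHn]; first exact: (sf_unit T).
by rewrite /= -IHn -addn1; exact: (sf_ot T n 1%N).
Qed.

(* T(alpha), regarded as a natural transformation T^n => T^m. *)
Definition rep_trans (M : category) (T : representation D (End M)) (n m : nat)
    (alpha : pro_hom D n m) :
    nattrans (fpow (rep_fun T 1) n) (fpow (rep_fun T 1) m) :=
  @cast_hom (EndCat M) _ _ _ _ (rep_pow T n) (rep_pow T m)
    (fmap (sf_fun T) (alpha : @hom D n m)).

Variables (C : monoidal) (M : actegory C).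

(* l_{c,T^{n-1}x} ∘ T(l_{c,T^{n-2}x}) ∘ ... ∘ T^{n-1}(l_{c,x}) *)
Fixpoint bin_pow (T : functor M M) (l : binatural T) (n : nat) (c : C) (x : M) :
    hom (fpow T n (c ◊ x)) (c ◊ fpow T n x) :=
  match n with
  | 0 => idc (c ◊ x)
  | k.+1 => bin_pow l k c (T x) ∘ fmap (fpow T k) (l c x)
  end.

Definition rep_pair : Type :=
  {T : representation D (End M) & binatural (rep_fun T 1)}.

Record compatible (p : rep_pair) : Prop := Compatible {
  compatible_unit : let T := rep_fun (projT1 p) 1 in let l := projT2 p in
    forall x : M, act_u (T x) ∘ l 𝟏 x = fmap T (act_u x);
  compatible_tensor : let T := rep_fun (projT1 p) 1 in let l := projT2 p in
    forall (A B : C) (x : M),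
    act_Psi A B (T x) ∘ l (A ⊗ B) x =
    (idc A ◊' l B x) ∘ l A (B ◊ x) ∘ fmap T (act_Psi A B x);
  compatible_mor : let l := projT2 p in
    forall (n m : nat) (alpha : pro_hom D n m) (c : C) (x : M),
    (idc c ◊' rep_trans (projT1 p) alpha x) ∘ bin_pow l n c x =
    bin_pow l m c x ∘ rep_trans (projT1 p) alpha (c ◊ x) }.

Definition rep_forget (T : representation D (EndC M)) : rep_pair :=
  existT _ (sf_comp (forget_colax M) T)
    (colax_zeta ((T : strict_functor D (EndC M)) 1%N : colax M)).

End Representations.

(* Main.v *)
Require Import Defs.
From mathcomp Require Import all_boot.
From mathcomp Require Import boolp.

Set Implicit Arguments.
Unset Strict Implicit.
Unset Printing Implicit Defensive.

Local Open Scope cat_scope.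

(** The coherence of a composite of colax equivariant endofunctors is determined
    by the coherences of its factors, so a single colax functor [F = (T, l)] has
    powers [(T^n, bin_pow l n)] ([colax_pow]).  The compatibility of [l] with a
    morphism [alpha : n -> m] of the PRO says precisely that the transformation
    [T^n => T^m] attached to [alpha] is a morphism between these powers.

    A strict representation [U] in [EndC M] satisfies [U n = (U 1)^n]
    ([rep_colax_pow]), because it sends [n + 1] to [U n] composed with [U 1].
    Hence every [U alpha] is, after transport along this equality, a morphism of
    powers, so that the pair under [U] is compatible ([rep_forget_compatible]).
    The same equality shows that [U] is determined on objects by [U 1]; on
    morphisms it is determined by its underlying representation, since a morphism
    of colax functors is a natural transformation with a property
    ([rep_forget_inj]).  Conversely, the unit and tensor laws make [(T, l)] a colax
    functor, [n |-> (T, l)^n] takes sums to composites ([colax_powD]), and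
    compatibility with the morphisms of the PRO lifts each transformation
    [T^n => T^m] to a morphism of powers; this is a preimage of the pair
    ([rep_lift], [rep_liftK]).

    Strictness holds only up to propositional equality of objects.  Equalities of
    morphisms are therefore carried along by [hom_eq], and an equality of colax
    functors is obtained from one of functors together with [hom_eq] of their
    coherences. *)

(** * Heterogeneous equality of morphisms *)

Lemma hom_eq_sym (C : category) (A B A' B' : C) (f : hom A B) (g : hom A' B') :
  hom_eq f g -> hom_eq g f.
Proof. by case; exact: hom_eq_refl. Qed.

Lemma hom_eq_cast (C : category) (A A' B B' : C) (eA : A = A') (eB : B = B')
    (f : hom A B) : hom_eq f (cast_hom eA eB f).
Proof. by case: _ / eA; case: _ / eB; exact: hom_eq_refl. Qed.

Lemma cast_hom_id (C : category) (A A' : C) (e : A = A') :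
  cast_hom e e (idc A) = idc A'.
Proof. by case: _ / e. Qed.

Lemma cast_hom_comp (C : category) (X X' Y Y' Z Z' : C)
    (eX : X = X') (eY : Y = Y') (eZ : Z = Z') (g : hom Y Z) (f : hom X Y) :
  cast_hom eX eZ (g ∘ f) = cast_hom eY eZ g ∘ cast_hom eX eY f.
Proof. by case: _ / eX; case: _ / eY; case: _ / eZ. Qed.

Lemma sm_map_hom_eq (E : strict_monoidal) (A A' B B' X X' Y Y' : E)
    (f : hom A A') (f' : hom X X') (g : hom B B') (g' : hom Y Y') :
  hom_eq f f' -> hom_eq g g' -> hom_eq (sm_map f g) (sm_map f' g').
Proof. by case=> {X X' f'}; case=> {Y Y' g'}; exact: hom_eq_refl. Qed.

Lemma hom_eq_nattrans (M : category) (F G F' G' : functor M M)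
    (a : nattrans F G) (b : nattrans F' G') :
  @hom_eq (EndCat M) F G a F' G' b -> forall x, hom_eq (a x) (b x).
Proof. by case=> x; exact: hom_eq_refl. Qed.

Lemma strict_functor_ext (D E : strict_monoidal) (U V : strict_functor D E) :
  (forall A, U A = V A) ->
  (forall A B (f : hom A B), hom_eq (fmap U f) (fmap V f)) -> U = V.
Proof.
move=> eob emap.
have {eob emap} : sf_fun U = sf_fun V by exact: functor_ext.
case: U V => [U U1 UD UM] [V V1 VD VM] /= e.
case: _ / e in V1 VD VM *.
by rewrite (Prop_irrelevance U1 V1) (Prop_irrelevance UD VD)
  (Prop_irrelevance UM VM).
Qed.

(** * Powers of a colax functor *)

Section Powers.
Variables (C : monoidal) (M : actegory C).

Lemma bin_pow_nat (T : functor M M) (l : binatural T) (n : nat)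
    (c c' : C) (x x' : M) (f : hom c c') (g : hom x x') :
  bin_pow l n c' x' ∘ fmap (fpow T n) (f ◊' g) =
  (f ◊' fmap (fpow T n) g) ∘ bin_pow l n c x.
Proof.
elim: n => [|n IHn] in x x' g *; first by rewrite /= comp_idl comp_idr.
by rewrite /= -comp_assoc -fmap_comp bin_nat fmap_comp comp_assoc IHn comp_assoc.
Qed.

Definition bin_pow_binatural (T : functor M M) (l : binatural T) (n : nat) :
    binatural (fpow T n) := Binatural (@bin_pow_nat T l n).

(** The functor and coherence of [colax_comp P F], with [P] the [n]-th power of
    [F], reduce to [fpow F n.+1] and [bin_pow (colax_zeta F) n.+1], so the laws
    pass from [n] to [n.+1] as those of a composite. *)
Lemma bin_pow_colax (F : colax M) (n : nat) :
  (forall x : M, act_u (fpow F n x) ∘ bin_pow (colax_zeta F) n 𝟏 x =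
     fmap (fpow F n) (act_u x)) /\
  (forall (A B : C) (x : M),
     act_Psi A B (fpow F n x) ∘ bin_pow (colax_zeta F) n (A ⊗ B) x =
     (idc A ◊' bin_pow (colax_zeta F) n B x)
       ∘ bin_pow (colax_zeta F) n A (B ◊ x) ∘ fmap (fpow F n) (act_Psi A B x)).
Proof.
elim: n => [|n [IHu IHt]].
  by split=> [x|A B x]; [exact: (colax_unit (colax_id M)) |
    exact: (colax_tensor (colax_id M))].
pose P := @Colax C M _ (bin_pow_binatural (colax_zeta F) n) IHu IHt.
by split=> [x|A B x]; [exact: (colax_unit (colax_comp P F)) |
  exact: (colax_tensor (colax_comp P F))].
Qed.

(** Built directly on [fpow] and [bin_pow], rather than by iterating
    [colax_comp], so that [compatible_mor] is literally the law of a morphism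
    between powers. *)
Definition colax_pow (F : colax M) (n : nat) : colax M :=
  @Colax C M (fpow F n) (bin_pow_binatural (colax_zeta F) n)
    (proj1 (bin_pow_colax F n)) (proj2 (bin_pow_colax F n)).

Lemma colax_pow0 (F : colax M) : colax_pow F 0 = colax_id M.
Proof. by apply: colax_ext => // c x; exact: hom_eq_refl. Qed.

Lemma colax_powS (F : colax M) (n : nat) :
  colax_pow F n.+1 = colax_comp (colax_pow F n) F.
Proof. by apply: colax_ext => // c x; exact: hom_eq_refl. Qed.

Lemma colax_pow1 (F : colax M) : colax_pow F 1 = F.
Proof. by rewrite colax_powS colax_pow0 colax_comp_idl. Qed.

Lemma colax_powD (F : colax M) (n m : nat) :
  colax_pow F (n + m) = colax_comp (colax_pow F n) (colax_pow F m).
Proof.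
elim: m => [|m IHm]; first by rewrite addn0 colax_pow0 colax_comp_idr.
by rewrite addnS !colax_powS IHm colax_comp_assoc.
Qed.

Lemma ch_nt_cast (F F' G G' : colax M) (eF : F = F') (eG : G = G')
    (eF' : colax_fun F = colax_fun F') (eG' : colax_fun G = colax_fun G')
    (a : colax_hom F G) :
  @cast_hom (EndCat M) _ _ _ _ eF' eG' (ch_nt a) =
  ch_nt (@cast_hom (EndCCat M) _ _ _ _ eF eG a).
Proof.
case: _ / eF in eF' *; case: _ / eG in eG' *.
by rewrite (Prop_irrelevance eF' erefl) (Prop_irrelevance eG' erefl).
Qed.

End Powers.

(** * From representations in colax functors to compatible pairs *)

Section Forget.
Variables (C : monoidal) (D : PRO) (M : actegory C).

Definition rep_colax (U : representation D (EndC M)) (n : nat) : colax M :=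
  (U : strict_functor D (EndC M)) n.

Lemma rep_colax_pow (U : representation D (EndC M)) (n : nat) :
  rep_colax U n = colax_pow (rep_colax U 1) n.
Proof.
elim: n => [|n IHn]; first by rewrite colax_pow0; exact: (sf_unit U).
by rewrite colax_powS -IHn -addn1; exact: (sf_ot U n 1%N).
Qed.

Lemma rep_forget_compatible (U : representation D (EndC M)) :
  compatible (rep_forget U).
Proof.
split=> [T l x|T l A B x|l n m alpha c x];
  [exact: colax_unit | exact: colax_tensor |].
(* The morphism of powers obtained from [U alpha] by transport has the same
   underlying transformation as [rep_trans]. *)
pose a : colax_hom (rep_colax U n) (rep_colax U m) :=
  fmap (sf_fun U) (alpha : @hom D n m).
rewrite /rep_trans.
rewrite (ch_nt_cast (rep_colax_pow U n) (rep_colax_pow U m) _ _ a).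
exact: (ch_colax (@cast_hom (EndCCat M) _ _ _ _
  (rep_colax_pow U n) (rep_colax_pow U m) a)).
Qed.

Lemma rep_pair_eq (p q : rep_pair D M) : p = q ->
  [/\ forall n, rep_fun (projT1 p) n = rep_fun (projT1 q) n,
      forall n m (alpha : @hom D n m) x,
        hom_eq ((fmap (sf_fun (projT1 p)) alpha : nattrans _ _) x)
               ((fmap (sf_fun (projT1 q)) alpha : nattrans _ _) x) &
      forall c x, hom_eq (projT2 p c x) (projT2 q c x)].
Proof. by move=> ->; split=> *; try exact: hom_eq_refl. Qed.

Lemma rep_pair_ext (p q : rep_pair D M) : projT1 p = projT1 q ->
  (forall c x, hom_eq (projT2 p c x) (projT2 q c x)) -> p = q.
Proof.
case: p q => [T l] [T' l'] /= e.
case: _ / e in l' * => el; congr existT.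
by apply: binatural_ext => c x; apply/hom_eqP.
Qed.

Lemma rep_forget_inj (U V : representation D (EndC M)) :
  rep_forget U = rep_forget V -> U = V.
Proof.
case/rep_pair_eq=> /= eob emap ezeta.
have e1 : rep_colax U 1 = rep_colax V 1 by apply: colax_ext (eob 1) ezeta.
have e n : rep_colax U n = rep_colax V n
    by rewrite (rep_colax_pow U n) (rep_colax_pow V n) e1.
apply: strict_functor_ext => [n|n m alpha]; first exact: e.
apply: colax_hom_hom_eq; [exact: e | exact: e | exact: emap].
Qed.

End Forget.

(** * Lifting a compatible pair *)

Section TransOfRep.
Variables (D : PRO) (M : category) (T : representation D (End M)).

Lemma rep_trans_hom_eq (n m : nat) (alpha : @hom D n m) x :
  hom_eq ((fmap (sf_fun T) alpha : nattrans _ _) x) (rep_trans T alpha x).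
Proof.
apply: hom_eq_nattrans; exact: (@hom_eq_cast (EndCat M)).
Qed.

Lemma rep_trans_id (n : nat) (x : M) :
  rep_trans T (pro_id D n) x = idc (fpow (rep_fun T 1) n x).
Proof.
by rewrite /rep_trans (fmap_id (sf_fun T) (n : D)) (@cast_hom_id (EndCat M)).
Qed.

Lemma rep_trans_comp (n m p : nat) (beta : pro_hom D m p)
    (alpha : pro_hom D n m) (x : M) :
  rep_trans T (pro_comp beta alpha) x = rep_trans T beta x ∘ rep_trans T alpha x.
Proof.
rewrite /rep_trans (fmap_comp (sf_fun T) (beta : @hom D m p) alpha).
by rewrite (@cast_hom_comp (EndCat M) _ _ _ _ _ _ _ (rep_pow T m)).
Qed.

Lemma rep_trans_tensor (n n' m m' : nat) (alpha : @hom D n n')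
    (beta : @hom D m m') (x : M) :
  hom_eq (rep_trans T (sm_map alpha beta) x)
         (nt_hcomp (rep_trans T alpha) (rep_trans T beta) x).
Proof.
apply: hom_eq_trans (hom_eq_sym (rep_trans_hom_eq _ x)) _.
apply: hom_eq_nattrans.
apply: hom_eq_trans (sf_map T alpha beta) _.
by apply: (@sm_map_hom_eq (End M)); exact: (@hom_eq_cast (EndCat M)).
Qed.

End TransOfRep.

Section Lift.
Variables (C : monoidal) (D : PRO) (M : actegory C).
Variables (p : rep_pair D M) (cp : compatible p).

Definition pair_colax : colax M :=
  @Colax C M _ (projT2 p) (compatible_unit cp) (compatible_tensor cp).

Definition pair_colax_hom (n m : nat) (alpha : pro_hom D n m) :
    colax_hom (colax_pow pair_colax n) (colax_pow pair_colax m) :=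
  @ColaxHom C M (colax_pow pair_colax n) (colax_pow pair_colax m)
    (rep_trans (projT1 p) alpha) (compatible_mor cp alpha).

Lemma pair_colax_hom_id (n : nat) :
  pair_colax_hom (pro_id D n) = ch_id (colax_pow pair_colax n).
Proof. by apply: colax_hom_ext => x; exact: rep_trans_id. Qed.

Lemma pair_colax_hom_comp (n m k : nat) (beta : pro_hom D m k)
    (alpha : pro_hom D n m) :
  pair_colax_hom (pro_comp beta alpha) =
  ch_comp (pair_colax_hom beta) (pair_colax_hom alpha).
Proof. by apply: colax_hom_ext => x; exact: rep_trans_comp. Qed.

Definition lift_functor : functor D (EndC M) :=
  @Functor D (EndC M) (colax_pow pair_colax) pair_colax_hom
    pair_colax_hom_id (fun n m k => @pair_colax_hom_comp n m k).

Lemma lift_functor_map (n n' m m' : D) (alpha : hom n n') (beta : hom m m') :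
  hom_eq (fmap lift_functor (sm_map alpha beta))
         (sm_map (fmap lift_functor alpha) (fmap lift_functor beta)).
Proof.
apply: colax_hom_hom_eq; [exact: colax_powD | exact: colax_powD |].
exact: rep_trans_tensor.
Qed.

Definition rep_lift : representation D (EndC M) :=
  @StrictFunctor D (EndC M) lift_functor (colax_pow0 pair_colax)
    (colax_powD pair_colax) lift_functor_map.

Lemma rep_liftK : rep_forget rep_lift = p.
Proof.
apply: rep_pair_ext => [|c x] /=.
  apply: strict_functor_ext => [n|n m alpha]; first by rewrite [RHS]rep_pow.
  apply: nattrans_hom_eq; [exact/esym/rep_pow | exact/esym/rep_pow |].
  by move=> x; apply: hom_eq_sym; exact: rep_trans_hom_eq.
by rewrite comp_idl; exact: hom_eq_refl.
Qed.

End Lift.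

Theorem mainTheorem3 (C : monoidal) (D : PRO) (M : actegory C) :
  exists H : forall T : representation D (EndC M), compatible (rep_forget T),
    bijective (fun T : representation D (EndC M) =>
      exist (@compatible D C M) (rep_forget T) (H T)).
Proof.
exists (@rep_forget_compatible C D M).
set f := (fun T => _).
pose g (q : {p : rep_pair D M | compatible p}) := rep_lift (proj2_sig q).
have gK : cancel g f.
  case=> p cp; apply: eq_exist; exact: rep_liftK.
have f_inj : injective f.
  by move=> U V /(congr1 (@proj1_sig _ _)); exact: rep_forget_inj.
exact: Bijective (inj_can_sym gK f_inj) gK.
Qed.
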